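(* Let $k\ge1$, $BP_1\in\{b,n\}^k$ and $IS_1\in\{\Box,\blacksquare\}^k$. Let $BP_2=(b,\dots,b)$ and let $IS_2\in\{\Box,\blacksquare\}^k$ be given by $IS_{2,i}=IS_{1,i}$ if $BP_{1,i}=BP_{2,i}$ and $IS_{2,i}=\overline{IS_{1,i}}$ otherwise, where $\overline{\Box}=\blacksquare$ and $\overline{\blacksquare}=\Box$. Then the standardizing translation $\sigma:\mathrm{LOCKSIMPLE}_{k,BP_1,IS_1}\to\mathrm{LOCKSIMPLE}_{k,BP_2,IS_2}$ is a correct translation.
   Context: The language LOCKSIMPLE$_{k,BP,IS}$, with blocking pattern $BP\in\{b,n\}^k$ and initial storage $IS\in\{\Box,\blacksquare\}^k$ ($\Box$ = empty, $\blacksquare$ = full). For each $i=1,\dots,k$ it has the operator symbols $P_i^m$, where $m$ is the $i$-th entry of $BP$, and $T_i^{\overline m}$, where $\overline b=n$, $\overline n=b$ (so exactly one of put/take on cell $i$ is blocking). Subprocesses are strings of operator symbols followed by $0$ or $\checkmark$; processes are finite parallel compositions $\mathcal U_1|\cdots|\mathcal U_r$ of subprocesses ($|$ associative and commutative). States are pairs $(\mathcal P,(C_1,\dots,C_k))$ with $C_i\in\{\Box,\blacksquare\}$. A step executes the first operator symbol of one subprocess: - $P_i^m$: if $C_i=\Box$, sets $C_i$ to $\blacksquare$; if $C_i=\blacksquare$ and $m=b$, it waits (no step possible); if $C_i=\blacksquare$ and $m=n$, it is executed and $C_i$ remains $\blacksquare$. - $T_i^m$: if $C_i=\blacksquare$,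 sets $C_i$ to $\Box$; if $C_i=\Box$ and $m=b$, it waits (no step possible); if $C_i=\Box$ and $m=n$, it is executed and $C_i$ remains $\Box$. A state is successful if its process has the form $\checkmark|\mathcal P$ (or is $\checkmark$). A state is may-convergent if it reduces in finitely many (possibly zero) steps to a successful state, and must-convergent if every state reachable from it is may-convergent. A process $\mathcal P$ is may-/must-convergent iff the state $(\mathcal P,IS)$ is. The standardizing translation $\sigma$ preserves the structure of processes (parallel composition, order of symbols, $0$, $\checkmark$) and acts on operator symbols of index $j$ as follows: if $BP_{1,j}=BP_{2,j}$ it is the identity; if $BP_{1,j}\neq BP_{2,j}$ then $\sigma(T_j^m)=P_j^m$ and $\sigma(P_j^m)=T_j^m$. A translation between two such languages is correct if every process $\mathcal P$ of the source is may-convergent iff its image is, and must-convergent iff its image is. *)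

(* Defs.v *)
From HB Require Import structures.
From Stdlib Require Import Relations.
From mathcomp Require Import all_boot.

Set Implicit Arguments.
Unset Strict Implicit.
Unset Printing Implicit Defensive.

Variant mode := Blocking | NonBlocking.

Definition dual (m : mode) : mode :=
  match m with Blocking => NonBlocking | NonBlocking => Blocking end.

Definition is_blocking (m : mode) : bool :=
  match m with Blocking => true | NonBlocking => false end.

Lemma is_blockingK :
  cancel is_blocking (fun c => if c then Blocking else NonBlocking).
Proof. by case. Qed.

HB.instance Definition _ := Equality.copy mode (can_type is_blockingK).

Variant cell := Empty | Full.

Definition flip (c : cell) : cell :=
  match c with Empty => Full | Full => Empty end.

(* Cells 1, ..., k are the ordinals 0, ..., k - 1. *)
Definition pattern (k : nat) := {ffun 'I_k -> mode}.
Definition storage (k : nat) := {ffun 'I_k -> cell}.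

Definition set_cell k (C : storage k) (i : 'I_k) (c : cell) : storage k :=
  [ffun j => if j == i then c else C j].

(* [Put i m] is P_i^m and [Take i m] is T_i^m.  All combinations are allowed
   here; [op_in BP] selects the symbols of the language with pattern BP. *)
Variant op (k : nat) :=
  | Put of 'I_k & mode
  | Take of 'I_k & mode.

Inductive subprocess (k : nat) :=
  | Stop
  | Check
  | Prefix of op k & subprocess k.

Arguments Stop {k}.
Arguments Check {k}.

Inductive process (k : nat) :=
  | Sub of subprocess k
  | Par of process k & process k.

(* The parallel composition is associative and commutative: processes are
   considered, reduced and tested for success modulo [cong]. *)
Inductive cong k : process k -> process k -> Prop :=
  | cong_refl p : cong p p
  | cong_sym p q : cong p q -> cong q p
  | cong_trans p q r : cong p q -> cong q r -> cong p r
  | cong_par p p' q q' : cong p p' -> cong q q' -> cong (Par p q) (Par p' q')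
  | cong_comm p q : cong (Par p q) (Par q p)
  | cong_assoc p q r : cong (Par (Par p q) r) (Par p (Par q r)).

Definition op_in k (BP : pattern k) (a : op k) : Prop :=
  match a with
  | Put i m => m = BP i
  | Take i m => m = dual (BP i)
  end.

Fixpoint subprocess_in k (BP : pattern k) (u : subprocess k) : Prop :=
  match u with
  | Stop | Check => True
  | Prefix a v => op_in BP a /\ subprocess_in BP v
  end.

Fixpoint process_in k (BP : pattern k) (p : process k) : Prop :=
  match p with
  | Sub u => subprocess_in BP u
  | Par q r => process_in BP q /\ process_in BP r
  end.

(* [None] means that the operation has to wait. *)
Definition exec k (a : op k) (C : storage k) : option (storage k) :=
  match a with
  | Put i m =>
      match C i, m with
      | Empty, _ => Some (set_cell C i Full)
      | Full, Blocking => None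
      | Full, NonBlocking => Some C
      end
  | Take i m =>
      match C i, m with
      | Full, _ => Some (set_cell C i Empty)
      | Empty, Blocking => None
      | Empty, NonBlocking => Some C
      end
  end.

Definition state (k : nat) := (process k * storage k)%type.

Inductive step k : state k -> state k -> Prop :=
  | step_op a u C C' :
      exec a C = Some C' -> step (Sub (Prefix a u), C) (Sub u, C')
  | step_par p p' q C C' :
      step (p, C) (p', C') -> step (Par p q, C) (Par p' q, C')
  | step_cong p p1 q1 q C C' :
      cong p p1 -> step (p1, C) (q1, C') -> cong q1 q ->
      step (p, C) (q, C').

Definition reaches k : state k -> state k -> Prop :=
  clos_refl_trans (state k) (@step k).

Definition successful k (s : state k) : Prop :=
  cong s.1 (Sub Check) \/ exists p, cong s.1 (Par (Sub Check) p).

Definition state_may k (s : state k) : Prop :=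
  exists t, reaches s t /\ successful t.

Definition state_must k (s : state k) : Prop :=
  forall t, reaches s t -> state_may t.

Definition may_convergent k (IS : storage k) (p : process k) : Prop :=
  state_may (p, IS).

Definition must_convergent k (IS : storage k) (p : process k) : Prop :=
  state_must (p, IS).

Definition is_translation k1 (BP1 : pattern k1) k2 (BP2 : pattern k2)
    (tau : process k1 -> process k2) : Prop :=
  forall p, process_in BP1 p -> process_in BP2 (tau p).

Definition correct_translation k1 (BP1 : pattern k1) (IS1 : storage k1)
    k2 (BP2 : pattern k2) (IS2 : storage k2)
    (tau : process k1 -> process k2) : Prop :=
  is_translation BP1 BP2 tau /\
  forall p, process_in BP1 p ->
    (may_convergent IS1 p <-> may_convergent IS2 (tau p)) /\
    (must_convergent IS1 p <-> must_convergent IS2 (tau p)).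

Section Sigma.
Variables (k : nat) (BP1 BP2 : pattern k).

Definition sigma_op (a : op k) : op k :=
  match a with
  | Put j m => if BP1 j == BP2 j then Put j m else Take j m
  | Take j m => if BP1 j == BP2 j then Take j m else Put j m
  end.

Fixpoint sigma_sub (u : subprocess k) : subprocess k :=
  match u with
  | Stop => Stop
  | Check => Check
  | Prefix a v => Prefix (sigma_op a) (sigma_sub v)
  end.

Fixpoint sigma (p : process k) : process k :=
  match p with
  | Sub u => Sub (sigma_sub u)
  | Par q r => Par (sigma q) (sigma r)
  end.

End Sigma.

(* Main.v *)
Require Import Defs.
From HB Require Import structures.
From Stdlib Require Import Relations.
From mathcomp Require Import all_boot.

Set Implicit Arguments.
Unset Strict Implicit.
Unset Printing Implicit Defensive.

(** Exchanging put and take on a cell while flipping its content leaves the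
    operational semantics unchanged. Hence [sigma], paired with the flip of the
    storage at the positions where the patterns differ, is an automorphism of
    the transition system. It is moreover an involution, so preservation of
    steps and success already yields their reflection. *)

Lemma flipK : involutive flip.
Proof. by case. Qed.

Section SigmaAutomorphism.
Variables (k : nat) (BP1 BP2 : pattern k).

Definition sigma_storage (C : storage k) : storage k :=
  [ffun i => if BP1 i == BP2 i then C i else flip (C i)].

Definition sigma_state (s : state k) : state k :=
  (sigma BP1 BP2 s.1, sigma_storage s.2).

Lemma sigma_opK : involutive (sigma_op BP1 BP2).
Proof. by case=> i m /=; case: ifP => /= ->. Qed.

Lemma sigma_subK : involutive (sigma_sub BP1 BP2).
Proof. by elim=> //= a u ->; rewrite sigma_opK. Qed.

Lemma sigmaK : involutive (sigma BP1 BP2).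
Proof. by elim=> [u | p IHp q IHq] /=; [rewrite sigma_subK | rewrite IHp IHq]. Qed.

Lemma sigma_storageK : involutive sigma_storage.
Proof. by move=> C; apply/ffunP=> i; rewrite !ffunE; case: eqP; rewrite ?flipK. Qed.

Lemma sigma_stateK : involutive sigma_state.
Proof. by case=> p C; rewrite /sigma_state /= sigmaK sigma_storageK. Qed.

(** Two distinct modes are dual to each other, so on a cell where the patterns differ the unchanged
    mode is the one that [BP2] prescribes for the exchanged symbol. *)
Lemma sigma_op_in a : op_in BP1 a -> op_in BP2 (sigma_op BP1 BP2 a).
Proof.
by case: a => i m /= ->; case: eqP => /= [-> // |]; case: (BP1 i) (BP2 i) => [] [].
Qed.

Lemma sigma_sub_in u : subprocess_in BP1 u -> subprocess_in BP2 (sigma_sub BP1 BP2 u).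
Proof. by elim: u => //= a u IHu [/sigma_op_in ? /IHu]. Qed.

Lemma sigma_is_translation : is_translation BP1 BP2 (sigma BP1 BP2).
Proof.
by elim=> [u /sigma_sub_in // | p IHp q IHq /= [/IHp ? /IHq]].
Qed.

Lemma sigma_set_cell C i c :
  sigma_storage (set_cell C i c) =
  set_cell (sigma_storage C) i (if BP1 i == BP2 i then c else flip c).
Proof.
by apply/ffunP=> j; rewrite !ffunE; case: (j =P i) => [->|].
Qed.

(** A put meets a full cell exactly as a take of the same mode meets an empty one. Since [omap]
    keeps [None], waiting is preserved as well as execution. *)
Lemma exec_sigma a C :
  exec (sigma_op BP1 BP2 a) (sigma_storage C) = omap sigma_storage (exec a C).
Proof.
case: a => i m /=; case E: (BP1 i == BP2 i); rewrite /= ffunE E;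
  by case: (C i) m => [] [] //=; rewrite sigma_set_cell E.
Qed.

(** [sigma] changes only the leaves of the tree of parallel compositions, so each rule of [cong]
    goes to an instance of itself. *)
Lemma cong_sigma p q : cong p q -> cong (sigma BP1 BP2 p) (sigma BP1 BP2 q).
Proof.
elim=> /= {p q} *; [exact: cong_refl | exact: cong_sym | | exact: cong_par
  | exact: cong_comm | exact: cong_assoc].
by apply: cong_trans; eassumption.
Qed.

Lemma step_sigma s t : step s t -> step (sigma_state s) (sigma_state t).
Proof.
elim=> {s t} [a u C C' aC | p p' q C C' _ IH | p p1 q1 q C C' pp1 _ IH q1q].
- by apply: step_op; rewrite exec_sigma aC.
- exact: step_par IH.
- exact: step_cong (cong_sigma pp1) IH (cong_sigma q1q).
Qed.

Lemma reaches_sigma s t : reaches s t -> reaches (sigma_state s) (sigma_state t).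
Proof.
elim=> {s t} [s t /step_sigma | s | s t u _ st _ tu]; first exact: rt_step.
- exact: rt_refl.
- exact: rt_trans st tu.
Qed.

Lemma successful_sigma s : successful s -> successful (sigma_state s).
Proof.
case=> [/cong_sigma | [p /cong_sigma]] sC; first by left.
by right; exists (sigma BP1 BP2 p).
Qed.

Lemma state_may_sigma s : state_may s -> state_may (sigma_state s).
Proof.
case=> t [/reaches_sigma st /successful_sigma tS].
by exists (sigma_state t).
Qed.

Lemma state_must_sigma s : state_must s -> state_must (sigma_state s).
Proof.
(* A state [t] reachable from the image of [s] is pulled back to [sigma_state t], reachable from
   [s]; its may-convergence is then carried forward to [t]. *)
move=> sM t /reaches_sigma; rewrite sigma_stateK => /sM /state_may_sigma.
by rewrite sigma_stateK.
Qed.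

Lemma sigma_correct IS :
  correct_translation BP1 IS BP2 (sigma_storage IS) (sigma BP1 BP2).
Proof.
split=> [|p _]; first exact: sigma_is_translation.
rewrite /may_convergent /must_convergent -[(sigma _ _ p, _)]/(sigma_state (p, IS)).
split; split.
- exact: state_may_sigma.
- by move/state_may_sigma; rewrite sigma_stateK.
- exact: state_must_sigma.
- by move/state_must_sigma; rewrite sigma_stateK.
Qed.

End SigmaAutomorphism.

Theorem theoremB4 (k : nat) (hk : 1 <= k)
    (BP1 BP2 : pattern k) (IS1 IS2 : storage k)
    (hBP2 : forall i, BP2 i = Blocking)
    (hIS2 : forall i,
       IS2 i = if BP1 i == BP2 i then IS1 i else flip (IS1 i)) :
  correct_translation BP1 IS1 BP2 IS2 (sigma BP1 BP2).
Proof.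
have -> : IS2 = sigma_storage BP1 BP2 IS1 by apply/ffunP=> i; rewrite ffunE.
exact: sigma_correct.
Qed.
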